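(* Let $L$ be a cyclic infinite dimensional Leibniz algebra over a field $F$. Then the monoid $\mathbf{Lend}(L)$ of all endomorphisms of $L$ is the union of an ideal $S$ with zero multiplication (that is, $f\circ g=0$ for all $f,g\in S$) and the submonoid $\mathbf{Mon}(L)$ of all monomorphisms of $L$. Furthermore, $\mathbf{Mon}(L)$ is a product $\mathbf{Mon}(L)=AD$ of an abelian submonoid $A$ and an abelian subgroup $D$ satisfying the following conditions: (i) $A\cap D=\langle 1\rangle$; (ii) $d^{-1}Ad=A$ for each element $d\in D$; (iii) $D$ is isomorphic to the multiplicative group of the field $F$; (iv) $A$ is isomorphic to the (multiplicative) submonoid of the polynomial ring $F[X]$ consisting of those polynomials whose free (constant) term is $1$; in particular, $A$ is a free abelian monoid.
   Context: A (left) Leibniz algebra over a field $F$ is an $F$-vector space $L$ with a bilinear operation $[\cdot,\cdot]$ satisfying $[a,[b,c]]=[[a,b],c]+[b,[a,c]]$ for all $a,b,c\in L$. It is cyclic if it is generated, as an algebra, by a single element. An endomorphism of $L$ is an $F$-linear map $f:L\to L$ with $f([a,b])=[f(a),f(b)]$ for all $a,b\in L$; $\mathbf{Lend}(L)$ is the set of all endomorphisms of $L$, a monoid under composition with the identity map as identity element. A monomorphism is an injective endomorphism. An ideal of a monoid $M$ is a subset $S\subseteq M$ with $sm\in S$ and $ms\in S$ for all $s\in S$, $m\in M$. Abelian means commutative. A subgroup of a monoid is a submonoid (with the same identity) that is a group. $\langle 1\rangle$ denotes the trivial submonoid consisting of the identity only. *)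

(* Defs.v *)
From HB Require Import structures.
From mathcomp Require Import all_boot all_algebra.
From mathcomp Require Import finmap multiset.
From mathcomp Require Import mathcomp_extra boolp classical_sets functions.

Set Implicit Arguments.
Unset Strict Implicit.
Unset Printing Implicit Defensive.

Import GRing.Theory.

Local Open Scope ring_scope.
Local Open Scope classical_set_scope.

HB.mixin Record Lmodule_isLeibniz (F : fieldType) L of GRing.Lmodule F L := {
  bracket : L -> L -> L;
  bracket_linearl : forall b, linear (bracket^~ b);
  bracket_linearr : forall a, linear (bracket a);
  bracket_leibniz : forall a b c,
    bracket a (bracket b c) = bracket (bracket a b) c + bracket b (bracket a c)
}.

#[short(type="leibnizAlgType")]
HB.structure Definition LeibnizAlgebra (F : fieldType) :=
  {L of GRing.Lmodule F L & Lmodule_isLeibniz F L}.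

Section LeibnizAlgebras.
Variables (F : fieldType) (L : leibnizAlgType F).

Definition subalgebra (B : set L) : Prop :=
  submod_closed [in B] /\ (forall a b, B a -> B b -> B (bracket a b)).

(* The subalgebra generated by [a] is the least one containing [a]. *)
Definition cyclic_algebra : Prop :=
  exists a : L, forall B : set L, subalgebra B -> B a -> B = setT.

Definition finite_dimensional : Prop :=
  exists s : seq L, forall x : L,
    exists c : 'I_(size s) -> F, x = \sum_(i < size s) c i *: s`_i.

Record lend := Lend {
  lend_fun :> L -> L;
  lend_linear : linear lend_fun;
  lend_bracket : {morph lend_fun : a b / bracket a b}
}.

HB.instance Definition _ (f : lend) :=
  GRing.isLinear.Build F L L *:%R (lend_fun f) (@lend_linear f).

HB.instance Definition _ := gen_eqMixin lend.
HB.instance Definition _ := gen_choiceMixin lend.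

Lemma lendP (f g : lend) : f =1 g -> f = g.
Proof.
case: f g => [f fl fb] [g gl gb] /= /funext fg.
by rewrite -{}fg in gl gb *; congr Lend; exact: Prop_irrelevance.
Qed.

Definition lend0 : lend.
Proof.
apply: (@Lend (fun=> 0)) => [k x y | a b].
- by rewrite scaler0 addr0.
- by have := bracket_linearr (0 : L) (-1) 0 0; rewrite !scaleN1r !addNr.
Defined.

Definition lend_one : lend.
Proof. by apply: (@Lend id). Defined.

Definition lend_mul (f g : lend) : lend.
Proof.
apply: (@Lend (f \o g)) => [k x y | a b] /=.
- by rewrite !lend_linear.
- by rewrite !lend_bracket.
Defined.

Lemma lend_mulA : associative lend_mul.
Proof. by move=> f g h; exact: lendP. Qed.

Lemma lend_mul1 : left_id lend_one lend_mul.
Proof. by move=> f; exact: lendP. Qed.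

Lemma lend_mulr1 : right_id lend_one lend_mul.
Proof. by move=> f; exact: lendP. Qed.

HB.instance Definition _ :=
  isMonoid.Build lend lend_mulA lend_mul1 lend_mulr1.

Definition monomorphisms : set lend := [set f : lend | injective f].

End LeibnizAlgebras.

Arguments cyclic_algebra {F} L.
Arguments finite_dimensional {F} L.
Arguments lend {F} L.
Arguments lend0 {F} L.
Arguments monomorphisms {F} L.

Section Monoids.
Local Open Scope group_scope.
Variable M : monoidType.
Implicit Types A S D : set M.

Definition submonoid A : Prop :=
  A 1 /\ (forall x y, A x -> A y -> A (x * y)).

Definition abelian_set A : Prop := forall x y, A x -> A y -> x * y = y * x.

Definition monoid_ideal S : Prop :=
  forall s m, S s -> S (s * m) /\ S (m * s).

Definition inverses (x y : M) : Prop := x * y = 1 /\ y * x = 1.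

Definition subgroup D : Prop :=
  submonoid D /\ (forall x, D x -> exists2 y, D y & inverses x y).

(* [A] and the multiplicative submonoid [B] of the ring [R] are isomorphic;
   only the values of [phi] on [B] matter. *)
Definition isomorphic_to_mul A (R : pzRingType) (B : set R) : Prop :=
  exists phi : R -> M,
    [/\ set_bij B A phi, phi 1%R = 1
      & forall p q, B p -> B q -> phi (p * q)%R = phi p * phi q].

(* The free abelian monoid on [I] is the monoid of finitely supported
   functions [I -> nat], that is of finite multisets over [I]. *)
Definition free_abelian_monoid A : Prop :=
  exists (I : choiceType) (phi : multiset I -> M),
    [/\ set_bij setT A phi, phi mset0 = 1
      & forall u v, phi (msetD u v) = phi u * phi v].

End Monoids.

(* Main.v *)
Require Import Defs.
From HB Require Import structures.
From mathcomp Require Import all_boot all_algebra.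
From mathcomp Require Import finmap multiset.
From mathcomp Require Import mathcomp_extra boolp classical_sets functions.

(** A cyclic Leibniz algebra is spanned by the left powers a, [a,a],
[a,[a,a]], ... of its generator a, because left multiplication by any power
after the first is zero ([left_power_kernel]).  So L is a quotient of F[X]
with the bracket [p, q] = p(0) q X, the constant polynomial 1 mapping to a;
the kernel of this map is an ideal of F[X], hence is zero as soon as L has
infinite dimension: [poly_eval] identifies L with F[X].

In this model an endomorphism f is determined by u = f(1).  Indeed
[1, q] = q X forces f(q X) = u(0) f(q) X, so that f(q) = q(u(0) X) u, and
conversely every polynomial u gives in this way an endomorphism [endo u]
([image_of_1K], [endoK]).  Composition is
  endo u o endo v = endo (v(u(0) X) u),
so chi : f |-> f(1)(0) is a monoid morphism from Lend(L) to the multiplicative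
monoid of F.  Everything can be read off from chi:
- f is injective exactly when chi f is nonzero ([lend_injective]), so that
  S = chi^-1(0) is an ideal complementary to Mon(L); when u(0) = v(0) = 0 the
  formula above gives endo u o endo v = 0 ([chi0_mul]);
- A = chi^-1(1) is stable under conjugation, and on it composition becomes the
  product of polynomials ([endoM_kernel]);
- the endomorphisms D = {endo c | c in F, c <> 0} form a copy of F^*, and chi
  restricted to D is the identity of F^*, whence Mon(L) = A D with trivial
  intersection.
Finally, F[X] being factorial, a polynomial with constant term 1 is a product
of irreducible polynomials with constant term 1, in a unique way since such
polynomials are associate only if they are equal.  This says that A is free
abelian on these irreducible polynomials. *)

Set Implicit Arguments.
Unset Strict Implicit.
Unset Printing Implicit Defensive.

Import GRing.Theory.

(** * A cyclic Leibniz algebra as a quotient of F[X] *)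

Section PolynomialModel.
Local Open Scope ring_scope.
Local Open Scope classical_set_scope.
Variables (F : fieldType) (L : leibnizAlgType F).
Implicit Types (a b c : L) (p q : {poly F}).

Lemma bracketDl b : {morph (bracket^~ b : L -> L) : x y / x + y}.
Proof. by move=> x y; have := bracket_linearl b 1 x y; rewrite !scale1r. Qed.

Lemma bracketDr a : {morph (bracket a : L -> L) : x y / x + y}.
Proof. by move=> x y; have := bracket_linearr a 1 x y; rewrite !scale1r. Qed.

Lemma bracket0l b : bracket (0 : L) b = 0.
Proof. by apply: (@addrI _ (bracket 0 b)); rewrite -bracketDl !addr0. Qed.

Lemma bracket0r a : bracket a (0 : L) = 0.
Proof. by apply: (@addrI _ (bracket a 0)); rewrite -bracketDr !addr0. Qed.

Lemma bracketZl k x b : bracket (k *: x : L) b = k *: bracket x b.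
Proof. by have := bracket_linearl b k x 0; rewrite bracket0l !addr0. Qed.

Lemma bracketZr a k x : bracket a (k *: x : L) = k *: bracket a x.
Proof. by have := bracket_linearr a k x 0; rewrite bracket0r !addr0. Qed.

Lemma bracket_suml b n (f : 'I_n -> L) :
  bracket (\sum_i f i) b = \sum_i bracket (f i) b.
Proof. exact: (big_morph (bracket^~ b) (bracketDl b) (bracket0l b)). Qed.

Lemma bracket_sumr a n (f : 'I_n -> L) :
  bracket a (\sum_i f i) = \sum_i bracket a (f i).
Proof. exact: (big_morph (bracket a) (bracketDr a) (bracket0r a)). Qed.

Variable a : L.

Definition left_power n := iter n (bracket a) a.

(** The Leibniz identity reads [[x, y], c] = [x, [y, c]] - [y, [x, c]].  For
x = y = a its right-hand side vanishes, and for y in the left annihilator of L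
both of its terms do. *)
Lemma left_power_kernel n c : bracket (left_power n.+1) c = 0.
Proof.
elim: n c => [|n IHn] c.
  by have /eqP := bracket_leibniz a a c; rewrite -subr_eq subrr eq_sym => /eqP.
have /eqP := bracket_leibniz a (left_power n.+1) c.
by rewrite !IHn bracket0r addr0 eq_sym => /eqP.
Qed.

(** The value at a of p, where X acts as left multiplication by a and the
constant polynomial 1 is sent to a. *)
Definition poly_eval p : L := \sum_(i < size p) p`_i *: left_power i.

Lemma poly_evalE n p : (size p <= n)%N ->
  poly_eval p = \sum_(i < n) p`_i *: left_power i.
Proof.
move=> le_pn; rewrite /poly_eval.
rewrite (big_ord_widen _ (fun i => p`_i *: left_power i) le_pn).
rewrite big_mkcond; apply: eq_bigr => i _.
by case: ltnP => // le_pi; rewrite nth_default // scale0r.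
Qed.

Lemma poly_eval_linear : linear poly_eval.
Proof.
move=> k p q; pose n := maxn (size p) (size q).
have le_pn : (size p <= n)%N by rewrite leq_maxl.
have le_qn : (size q <= n)%N by rewrite leq_maxr.
have le_kn : (size (k *: p + q)%R <= n)%N.
  by rewrite (leq_trans (size_polyD _ _)) // geq_max le_qn
             (leq_trans (size_scale_leq _ _)).
rewrite !(@poly_evalE n) // scaler_sumr -big_split.
by apply: eq_bigr => i _; rewrite coefD coefZ scalerDl scalerA.
Qed.

HB.instance Definition _ :=
  GRing.isLinear.Build F {poly F} L *:%R poly_eval poly_eval_linear.

Lemma poly_evalMX p : poly_eval (p * 'X) = bracket a (poly_eval p).
Proof.
have le_pX : (size (p * 'X)%R <= (size p).+1)%N.
  by rewrite (leq_trans (size_polyMleq _ _)) // size_polyX addn2.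
rewrite (poly_evalE le_pX) big_ord_recl coefMX scale0r add0r bracket_sumr.
by apply: eq_bigr => i _; rewrite coefMX bracketZr.
Qed.

Lemma poly_eval1 : poly_eval 1 = a.
Proof. by rewrite (@poly_evalE 1) ?size_poly1 // big_ord1 coef1 scale1r. Qed.

(** Left multiplication by [poly_eval p] only sees the component of p on the
generator, the higher powers acting by zero. *)
Lemma bracket_poly_eval p q :
  bracket (poly_eval p) (poly_eval q) = poly_eval (p`_0 *: (q * 'X)).
Proof.
rewrite (poly_evalE (leqnSn (size p))) bracket_suml.
rewrite big_ord_recl /= big1 => [|i _].
  by rewrite addr0 bracketZl linearZ /= poly_evalMX.
by rewrite bracketZl left_power_kernel scaler0.
Qed.

(** Left multiplication by a turns a linear relation between the left powers of
a into another one. *)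
Lemma poly_eval_ideal p q : poly_eval p = 0 -> poly_eval (q * p) = 0.
Proof.
move=> p0; elim/poly_ind: q => [|q c IHq]; first by rewrite mul0r linear0.
rewrite mulrDl linearD /= -mulrA ['X * p]mulrC mulrA poly_evalMX IHq.
by rewrite bracket0r add0r mul_polyC linearZ /= p0 scaler0.
Qed.

Hypothesis a_gen : forall B : set L, subalgebra B -> B a -> B = setT.

Lemma poly_eval_surj x : exists p, poly_eval p = x.
Proof.
suff: range poly_eval x by case=> p _ <-; exists p.
rewrite (@a_gen (range poly_eval)) //; last by exists 1; rewrite ?poly_eval1.
split; last first.
  by move=> _ _ [p _ <-] [q _ <-]; rewrite bracket_poly_eval; eexists.
split; first by rewrite inE; exists 0; rewrite ?linear0.
move=> k _ _ /set_mem[p _ <-] /set_mem[q _ <-]; apply/mem_set.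
by exists (k *: p + q); rewrite ?linearP.
Qed.

Hypothesis infL : ~ finite_dimensional L.

(** A nonzero relation p would let every polynomial be replaced by its remainder
modulo p, and the first [size p] left powers would already span L. *)
Lemma poly_eval_inj : injective poly_eval.
Proof.
apply: raddf_inj => p p0; apply/eqP/negPn/negP => pn0; apply: infL.
exists (mkseq left_power (size p)) => x; have [q <-] := poly_eval_surj x.
exists (fun i => (q %% p)`_i); rewrite size_mkseq.
rewrite {1}(divp_eq q p) linearD /= poly_eval_ideal // add0r.
rewrite (@poly_evalE (size p)); last by rewrite ltnW // ltn_modp.
by apply: eq_bigr => i _; rewrite nth_mkseq.
Qed.

End PolynomialModel.

(** * Unique factorization of polynomials with constant term 1 *)

Section Factorization.
Local Open Scope ring_scope.
Variable F : fieldType.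
Implicit Types (p q : {poly F}).

Definition normalized_irreducible p := (p`_0 == 1) && `[< irreducible_poly p >].

Lemma eqp_coef0_eq p q : p`_0 = 1 -> q`_0 = 1 -> p %= q -> p = q.
Proof.
move=> p1 q1 /eqpP[[c d] /= /andP[cn0 dn0] cpdq].
have /(congr1 (fun r : {poly F} => r`_0)) := cpdq.
rewrite !coefZ p1 q1 !mulr1 => cd; move: cpdq; rewrite -cd.
exact/scalerI.
Qed.

Definition irreducible_factor := {p | normalized_irreducible p}.

Lemma prime_dvdp_prod (I : eqType) p (r : seq I) (f : I -> {poly F}) :
  irreducible_poly p -> p %| \prod_(i <- r) f i ->
  exists2 i, i \in r & p %| f i.
Proof.
move=> irr_p; elim: r => [|i r IHr].
  rewrite big_nil dvdp1; case: irr_p => + _ => /[swap] /eqP ->.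
  by rewrite ltnn.
rewrite big_cons; have [pi _|npi] := boolP (p %| f i).
  by exists i; rewrite ?inE ?eqxx.
rewrite Gauss_dvdpr; last first.
  rewrite /coprimep; have [d|] := irredp_XsubCP irr_p (dvdp_gcdl p (f i)).
    by rewrite (eqp_size d) size_poly1.
  move=> pd; case/negP: npi.
  by rewrite -(eqp_dvdl _ pd) dvdp_gcdr.
by case/IHr => j jr pj; exists j; rewrite ?inE ?jr ?orbT.
Qed.

Lemma coef0_prod1 (r : seq irreducible_factor) : (\prod_(x <- r) val x)`_0 = 1.
Proof.
elim/big_rec: _ => [|x p _ p1]; first by rewrite coef1.
by rewrite coef0M p1 mulr1; have /andP[/eqP] := valP x.
Qed.

Lemma irreducible_factor_dvdp_eq (x y : irreducible_factor) :
  val x %| val y -> x = y.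
Proof.
have /andP[/eqP x1 /asboolP irr_x] := valP x.
have /andP[/eqP y1 /asboolP irr_y] := valP y.
move=> xy; apply/val_inj/eqp_coef0_eq => //; apply: irr_y.2 => //.
by rewrite gtn_eqF // irr_x.1.
Qed.

(** By Euclid's lemma each factor of one product divides, hence equals, some
factor of the other; both are then cancelled. *)
Lemma factorization_uniq (r s : seq irreducible_factor) :
  \prod_(x <- r) val x = \prod_(x <- s) val x -> perm_eq r s.
Proof.
elim: r s => [|x r IHr] s.
  case: s => // y s; rewrite big_nil big_cons => ys1.
  have /andP[_ /asboolP [+ _]] := valP y.
  have /(dvdp_mulr (\prod_(x <- s) val x)) := dvdpp (val y).
  by rewrite -ys1 dvdp1 => /eqP ->.
have /andP[/eqP x1 /asboolP irr_x] := valP x.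
rewrite big_cons => xrs.
have [|y ys /irreducible_factor_dvdp_eq xy] :=
  prime_dvdp_prod (r := s) (f := val) irr_x.
  by rewrite -xrs dvdp_mulr.
rewrite -{y}xy in ys; rewrite perm_sym (perm_trans (perm_to_rem ys)) //.
rewrite perm_cons perm_sym IHr //; apply: (mulfI (irredp_neq0 irr_x)).
by rewrite xrs (perm_big _ (perm_to_rem ys)) big_cons.
Qed.

(** In a proper factorization q' * q of p both constant terms are nonzero with
product 1, so dividing each factor by its constant term gives two smaller
polynomials with constant term 1 and the same product. *)
Lemma factorization_exists p : p`_0 = 1 ->
  exists r : seq irreducible_factor, p = \prod_(x <- r) val x.
Proof.
have [n] := ubnP (size p); elim: n p => // n IHn p lepn p1.
have pn0 : p != 0.
  by apply: contra_eq_neq p1 => ->; rewrite coef0 eq_sym oner_neq0.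
have [irr_p|] := pselect (irreducible_poly p).
  have np : normalized_irreducible p.
    by rewrite /normalized_irreducible p1 eqxx; apply/asboolP.
  by exists [:: exist _ p np]; rewrite big_seq1.
have [sp1 _|sp1 /not_andP[//|]] := leqP (size p) 1.
  by exists [::]; rewrite big_nil (size1_polyC sp1) p1.
move=> /existsNP[q] /not_implyP[q1 /not_implyP[qp npq]].
have [q' pE] := dvdpP _ _ qp.
have qq' : q'`_0 * q`_0 = 1 by rewrite -coef0M -pE.
have c0 : q`_0 != 0 by
  apply: contra_eq_neq qq' => ->; rewrite mulr0 eq_sym oner_neq0.
have c'0 : q'`_0 != 0 by
  apply: contra_eq_neq qq' => ->; rewrite mul0r eq_sym oner_neq0.
have qn0 : q != 0 by apply: contraNneq c0 => ->; rewrite coef0.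
have q'n0 : q' != 0 by apply: contraNneq c'0 => ->; rewrite coef0.
have q_gt1 : (1 < size q)%N.
  by rewrite ltn_neqAle eq_sym q1 size_poly_gt0.
have q'_gt1 : (1 < size q')%N.
  rewrite ltn_neqAle eq_sym size_poly_gt0 q'n0 andbT.
  apply: contra_notN npq => /eqP s1.
  by rewrite -dvdp_size_eqp // pE size_mul // s1 add1n.
have spE : size p = (size q' + size q).-1 by rewrite pE size_mul.
have factor (s : {poly F}) : s`_0 != 0 -> (size s < size p)%N ->
    exists r : seq irreducible_factor, (s`_0)^-1 *: s = \prod_(x <- r) val x.
  move=> s0 lt_sp; apply: IHn; last by rewrite coefZ mulVf.
  by rewrite size_scale ?invr_eq0 // (leq_trans lt_sp).
have [r rE] : exists r : seq irreducible_factor,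
    (q`_0)^-1 *: q = \prod_(x <- r) val x.
  by apply: factor; rewrite // spE -(subnKC q'_gt1) /= ltnS leq_addl.
have [r' r'E] : exists r : seq irreducible_factor,
    (q'`_0)^-1 *: q' = \prod_(x <- r) val x.
  by apply: factor; rewrite // spE addnC -(subnKC q_gt1) /= ltnS leq_addl.
exists (r' ++ r); rewrite big_cat /= -rE -r'E -scalerAl -scalerAr scalerA.
by rewrite -invfM qq' invr1 scale1r -pE.
Qed.

End Factorization.

(** * The endomorphism monoid of F[X] with the bracket p(0) q X *)

Section EndomorphismsOfTheModel.
Local Open Scope ring_scope.
Variables (F : fieldType) (L : leibnizAlgType F).
Variables (ev : {linear {poly F} -> L}) (coords : L -> {poly F}).
Hypothesis evK : cancel ev coords.
Hypothesis coordsK : cancel coords ev.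
Hypothesis bracket_ev :
  forall p q, bracket (ev p) (ev q) = ev (p`_0 *: (q * 'X)).
Implicit Types (p q u v : {poly F}) (f g : lend L).

(** The formula for the endomorphism that maps 1 to u. *)
Definition substitution u p := (p \Po (u`_0 *: 'X)) * u.

Lemma coef0_substitution u p : (substitution u p)`_0 = p`_0 * u`_0.
Proof.
rewrite /substitution coef0M; congr (_ * _).
by rewrite -!horner_coef0 horner_comp hornerZ hornerX mulr0.
Qed.

Lemma coords_linear : linear coords.
Proof.
move=> k x y; apply: (can_inj evK).
by rewrite linearP /= !coordsK.
Qed.

Definition endo u : lend L.
Proof.
apply: (@Lend _ _ (fun x => ev (substitution u (coords x)))).
- move=> k x y; rewrite coords_linear /substitution comp_polyD comp_polyZ.
  by rewrite mulrDl -scalerAl linearP.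
- move=> x y; rewrite bracket_ev -{1}[x]coordsK -{1}[y]coordsK bracket_ev evK.
  congr (ev _); rewrite coef0_substitution /substitution comp_polyZ comp_polyM.
  rewrite comp_polyX -scalerAr -!scalerAl scalerA; congr (_ *: _).
  by rewrite -!mulrA ['X * u]mulrC.
Defined.

Lemma endoE u p : endo u (ev p) = ev (substitution u p).
Proof. by rewrite /= evK. Qed.

Definition image_of_1 f := coords (f (ev 1)).

(** An endomorphism commutes with X up to the factor u(0), where u is the image
of 1, because multiplication by X is the bracket with 1; it is therefore given
by the substitution formula on all powers of X. *)
Lemma image_of_1K : cancel image_of_1 endo.
Proof.
move=> f; apply: lendP => x; rewrite -[x]coordsK endoE.
elim/poly_ind: (coords x) => [|p c IHp].
  by rewrite /substitution comp_poly0 mul0r !linear0.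
have fE : f (ev 1) = ev (image_of_1 f) by rewrite coordsK.
have -> : ev (p * 'X + c%:P) = bracket (ev 1) (ev p) + c *: ev 1.
  by rewrite bracket_ev coef1 scale1r linearD -[c *: _]linearZ /= alg_polyC.
rewrite linearD linearZ /= lend_bracket -IHp fE bracket_ev -linearZ -linearD.
congr (ev _); rewrite /substitution comp_polyD comp_polyM comp_polyX comp_polyC.
by rewrite mulrDl mul_polyC -scalerAr -scalerAl -!mulrA ['X * _]mulrC.
Qed.

Lemma endoK : cancel endo image_of_1.
Proof.
by move=> u; rewrite /image_of_1 endoE evK /substitution comp_polyC mul1r.
Qed.

Lemma endoM u v : (endo u * endo v)%g = endo (substitution u v).
Proof.
rewrite -[LHS]image_of_1K; congr endo.
by rewrite /image_of_1 /= !evK {2}/substitution comp_polyC mul1r.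
Qed.

Lemma endo1 : endo 1 = 1%g.
Proof.
apply: lendP => x; rewrite -[x]coordsK endoE.
by rewrite /substitution coef1 scale1r comp_polyXr mulr1.
Qed.

(** The character of the monoid of endomorphisms that governs its structure: by
[chiM] the constant term of the image of 1 is multiplicative. *)
Definition chi f := (image_of_1 f)`_0.

Lemma chi_endo u : chi (endo u) = u`_0.
Proof. by rewrite /chi endoK. Qed.

Lemma chi1 : chi 1%g = 1.
Proof. by rewrite -endo1 chi_endo coef1. Qed.

Lemma chiM f g : chi (f * g)%g = chi f * chi g.
Proof.
rewrite -[f]image_of_1K -[g]image_of_1K endoM !chi_endo coef0_substitution.
exact: mulrC.
Qed.

(** If u(0) = 0, the substitution X := u(0) X kills X; otherwise it is
invertible, and multiplication by u is injective. *)
Lemma lend_injective f : injective f <-> chi f != 0.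
Proof.
rewrite -[f]image_of_1K chi_endo; set u := image_of_1 f; split.
  move=> inj_u; apply/negP => /eqP u0.
  have /inj_u /(can_inj evK) /eqP : endo u (ev 'X) = endo u (ev 0).
    by rewrite !endoE /substitution u0 scale0r !comp_poly0r coefX coef0.
  by rewrite polyX_eq0.
move=> u0; have un0 : u != 0 by apply: contraNneq u0 => ->; rewrite coef0.
apply: raddf_inj => x; rewrite -[x]coordsK; set p := coords x => fp0.
have /(can_inj evK)/eqP : ev (substitution u p) = ev 0.
  by rewrite -endoE linear0; exact: fp0.
rewrite mulf_eq0 (negPf un0) orbF comp_poly2_eq0 => [/eqP -> |].
  by rewrite linear0.
by rewrite size_scale // size_polyX.
Qed.

(** When u(0) = 0, [endo u] sends p to p(0) u, and every value of [endo v] has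
constant term 0 when v(0) = 0. *)
Lemma chi0_mul f g : chi f = 0 -> chi g = 0 -> (f * g)%g = lend0 L.
Proof.
rewrite -[f]image_of_1K -[g]image_of_1K !chi_endo => u0 v0.
rewrite endoM /substitution u0 scale0r comp_poly0r v0 mul0r.
by apply: lendP => x; rewrite /= /substitution mulr0 linear0.
Qed.

(** The substitution X := p(0) X is trivial when p(0) = 1, which leaves the
multiplication by p. *)
Lemma endoM_kernel p q : p`_0 = 1 -> (endo p * endo q)%g = endo (p * q).
Proof.
by move=> p1; rewrite endoM /substitution p1 scale1r comp_polyXr mulrC.
Qed.

Definition dilation (c : F) := endo c%:P.

Lemma chi_dilation c : chi (dilation c) = c.
Proof. by rewrite chi_endo coefC. Qed.

Lemma dilationM c d : dilation (c * d) = (dilation c * dilation d)%g.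
Proof. by rewrite /dilation endoM /substitution comp_polyC -polyCM mulrC. Qed.

Lemma dilation1 : dilation 1 = 1%g.
Proof. exact: endo1. Qed.

Lemma kernel_dilation_factor f : chi f != 0 ->
  f = (endo ((chi f)^-1 *: image_of_1 f) * dilation (chi f))%g.
Proof.
move=> f0; rewrite /dilation endoM /substitution comp_polyC mul_polyC scalerA.
by rewrite divff // scale1r image_of_1K.
Qed.

End EndomorphismsOfTheModel.

(** * The structure of the monoid of endomorphisms *)

Local Open Scope group_scope.
Local Open Scope classical_set_scope.

Lemma isomorphic_to_mul_image (M : monoidType) (R : pzRingType)
    (phi : R -> M) (A : set M) (B : set R) :
  injective phi -> phi @` B = A -> phi 1%R = 1 ->
  (forall p q, B p -> B q -> phi (p * q)%R = phi p * phi q) ->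
  isomorphic_to_mul A B.
Proof.
move=> inj_phi <- phi1 phiM; exists phi; split=> //; split=> // p q _ _.
exact: inj_phi.
Qed.

(** By unique factorization, multisets of irreducible polynomials with constant
term 1 correspond to their products. *)
Lemma isomorphic_to_normalized_free (F : fieldType) (M : monoidType)
    (A : set M) :
  isomorphic_to_mul A [set p : {poly F} | p`_0 = 1]%R ->
  free_abelian_monoid A.
Proof.
move=> [phi [[phi_fun phi_inj phi_surj] phi1 phiM]].
have prod1 (u : multiset (irreducible_factor F)) :
    ((\prod_(x <- u) val x)`_0 = 1)%R.
  exact: coef0_prod1.
exists (irreducible_factor F), (fun u => phi (\prod_(x <- u) val x)%R); split.
- split=> [u _ | u v _ _ uv | f Af].
  + exact/phi_fun/prod1.
  + have /factorization_uniq /eq_seq_msetP :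
        (\prod_(x <- u) val x = \prod_(x <- v) val x)%R.
      by apply: phi_inj uv; apply/mem_set/prod1.
    by rewrite !seq_mset_id.
  + have [p p1 <-] := phi_surj f Af.
    have [r ->] := factorization_exists p1.
    exists (seq_mset r) => //.
    by rewrite (perm_big _ (perm_eq_seq_mset r)).
- by rewrite big_mset0.
- move=> u v; rewrite -phiM ?prod1 //; congr phi.
  rewrite -big_cat; apply: perm_big; apply/allP => x _ /=.
  by rewrite count_cat !count_mem_mset msetE2.
Qed.

Theorem theorem0p1 (F : fieldType) (L : leibnizAlgType F) :
  cyclic_algebra L -> ~ finite_dimensional L ->
  (exists S : set (lend L),
     [/\ monoid_ideal S,
         (forall f g : lend L, S f -> S g -> f * g = lend0 L),
         submonoid (monomorphisms L)
       & [set: lend L] = S `|` monomorphisms L])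
  /\
  (exists A D : set (lend L),
     [/\ submonoid A, abelian_set A, subgroup D, abelian_set D
       & monomorphisms L = [set a * d | a in A & d in D]]
     /\
     [/\ A `&` D = [set 1],
         (forall d d' : lend L, D d -> inverses d d' ->
            [set d' * a * d | a in A] = A),
         isomorphic_to_mul D [set x : F | x != 0%R],
         isomorphic_to_mul A [set p : {poly F} | p`_0 = 1]%R
       & free_abelian_monoid A]).
Proof.
move=> [a a_gen] infL.
pose ev := poly_eval a : {linear {poly F} -> L}.
have [coords coordsK] := choice (poly_eval_surj a_gen).
have evK : cancel ev coords.
  by move=> p; apply: (poly_eval_inj a_gen infL); exact: coordsK.
have evB := bracket_poly_eval a : forall p q,
  bracket (ev p) (ev q) = ev (p`_0 *: (q * 'X))%R.
pose X := chi ev coords; pose E := endo evK coordsK evB.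
pose D_ := dilation evK coordsK evB.
have XM f g : X (f * g) = (X f * X g)%R by exact: chiM.
have X1 : X 1 = 1%R by exact: chi1.
have XE p : X (E p) = (p`_0)%R by exact: chi_endo.
have XD c : X (D_ c) = c by exact: chi_dilation.
have EK f : E (image_of_1 ev coords f) = f by exact: image_of_1K.
have DM c d : D_ (c * d)%R = D_ c * D_ d by exact: dilationM.
have D1 : D_ 1%R = 1 by exact: dilation1.
have XV d d' : inverses d d' -> (X d' * X d)%R = 1%R.
  by case=> _ d'd; rewrite -XM d'd.
have monE : monomorphisms L = [set f | X f != 0%R].
  by apply/seteqP; split=> f /(lend_injective evK coordsK evB).
split.
  exists [set f | X f = 0%R]; split.
  - by move=> s m /= s0; rewrite !XM s0 mul0r mulr0.
  - by move=> f g; exact: chi0_mul.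
  - rewrite monE; split=> [|f g /= f0 g0]; first by rewrite /= X1 oner_neq0.
    by rewrite XM mulf_neq0.
  - rewrite monE; apply/seteqP; split=> // f _ /=.
    by have [] := eqVneq (X f) 0%R; [left | right].
have AE : E @` [set p : {poly F} | p`_0 = 1]%R = [set f | X f = 1%R].
  apply/seteqP; split=> [_ [p p1 <-] | f f1] /=; first by rewrite XE.
  by exists (image_of_1 ev coords f); rewrite ?EK.
have EM (p q : {poly F}) : (p`_0 = 1)%R -> E (p * q)%R = E p * E q.
  by move=> p1; rewrite /E endoM_kernel.
have isoA : isomorphic_to_mul [set f | X f = 1%R]
    [set p : {poly F} | p`_0 = 1]%R.
  apply: (isomorphic_to_mul_image (can_inj (endoK evK coordsK evB)) AE).
    exact: endo1.
  by move=> p q p1 _; exact: EM.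
exists [set f | X f = 1%R], (D_ @` [set c | c != 0%R]); split; split.
- by split=> // f g /= f1 g1; rewrite XM f1 g1 mulr1.
- move=> f g; rewrite -AE => -[p p1 <-] [q q1 <-].
  by rewrite -!EM // mulrC.
- split.
    split; first by exists 1%R => //=; rewrite oner_neq0.
    move=> _ _ [c c0 <-] [d d0 <-]; exists (c * d)%R => //=.
    by rewrite mulf_neq0.
  move=> _ [c c0 <-]; exists (D_ (c^-1)%R).
    by exists (c^-1)%R; rewrite //= invr_eq0.
  by split; rewrite -DM ?mulVf ?divff.
- by move=> _ _ [c _ <-] [d _ <-]; rewrite -!DM mulrC.
- rewrite monE; apply/seteqP; split=> [f /= f0 | _ /= [f f1 [_ [c c0 <-] <-]]].
    exists (E ((X f)^-1 *: image_of_1 ev coords f)%R).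
      by rewrite /= XE coefZ mulVf.
    exists (D_ (X f)); first by exists (X f).
    exact/esym/kernel_dilation_factor.
  by rewrite XM f1 mul1r XD.
- apply/seteqP; split=> [f /= [f1 [c _ cf]] | _ ->] /=.
    by rewrite -cf -(XD c) cf f1.
  by split=> //; exists 1%R; rewrite //= oner_neq0.
- move=> d d' _ dd'; have [dV d'V] := dd'.
  have Xdd' := XV _ _ dd'.
  apply/seteqP; split=> [_ [f /= f1 <-] | f /= f1] /=.
    by rewrite !XM f1 mulr1.
  (* chi takes values in a commutative monoid, so the reverse conjugate of f
     lies in A as well. *)
  exists (d * f * d') => /=; first by rewrite !XM f1 mulr1 mulrC.
  by rewrite !mulgA d'V mul1g -mulgA d'V mulg1.
- apply: (@isomorphic_to_mul_image _ _ D_) => //.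
  exact: can_inj XD.
- exact: isoA.
- exact: isomorphic_to_normalized_free isoA.
Qed.
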